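(* Let $\dot G=(G,\sigma)$ be a connected unbalanced signed graph of order $n$. If $\dot G$ is $C_3^-$-free, then $\rho(\dot G)\le \frac12\left(\sqrt{n^2-8}+n-4\right)$, with equality if and only if $\dot G\sim \dot G^{1,n-3}$.
   Context: A signed graph $\dot G=(G,\sigma)$ is a simple graph $G$ with a sign function $\sigma:E(G)\to\{+1,-1\}$; its adjacency matrix $A_\sigma$ has $(i,j)$ entry $\sigma(v_iv_j)$ if $v_i\sim v_j$ and $0$ otherwise, with eigenvalues $\lambda_1\ge\dots\ge\lambda_n$, and $\rho(\dot G)=\max\{\lambda_1,-\lambda_n\}$. The sign of a cycle is the product of its edge signs; $\dot G$ is unbalanced if some cycle has sign $-1$. $\dot G$ is $C_3^-$-free if it contains no triangle of sign $-1$. Switching at $U\subseteq V(G)$ reverses the signs of edges between $U$ and its complement; $\sim$ denotes switching equivalence (up to isomorphism). For $s,t\ge1$ with $s+t=n-2$, $\dot G^{s,t}$ is obtained from the all-positive complete graph on $u_1,\dots,u_s,v_1,\dots,v_t$ and two further vertices $u,v$ by adding the negative edge $uv$ and positive edges $uu_1,\dots,uu_s,vv_1,\dots,vv_t$. *)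

(* Defs.v *)
From HB Require Import structures.
From mathcomp Require Import all_boot all_order all_algebra.
From mathcomp Require Import reals.
From mathcomp Require Import polyrcf.

Set Implicit Arguments.
Unset Strict Implicit.
Unset Printing Implicit Defensive.

Import Order.TTheory GRing.Theory Num.Theory.
Local Open Scope ring_scope.

(* [sign] is meaningful on adjacent pairs only; no notion below depends on its
   values elsewhere. *)
Record signed_graph (T : finType) := SignedGraph {
  adj : rel T;
  sign : T -> T -> int;
  adj_sym : symmetric adj;
  adj_irr : irreflexive adj;
  sign_sym : forall x y, sign x y = sign y x;
  sign_pm1 : forall x y, adj x y -> sign x y = 1 \/ sign x y = -1
}.

Section SignedGraphs.
Variable T : finType.
Implicit Types (G : signed_graph T) (c : seq T) (U : {set T}).

Definition connected G := forall x y : T, connect (adj G) x y.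

Definition is_cycle G c := [&& (2 < size c)%N, uniq c & cycle (adj G) c].

Definition cycle_sign G c : int := \prod_(x <- c) sign G x (next c x).

Definition unbalanced G := exists c, is_cycle G c /\ cycle_sign G c = -1.

Definition C3neg_free G :=
  ~ exists c, [/\ is_cycle G c, size c = 3%N & cycle_sign G c = -1].

Definition switch_sign G U x y : int :=
  if (x \in U) (+) (y \in U) then - sign G x y else sign G x y.

Lemma switch_sign_sym G U x y : switch_sign G U x y = switch_sign G U y x.
Proof. by rewrite /switch_sign addbC sign_sym. Qed.

Lemma switch_sign_pm1 G U x y :
  adj G x y -> switch_sign G U x y = 1 \/ switch_sign G U x y = -1.
Proof.
rewrite /switch_sign => /sign_pm1.
by case: ifP => _ [] ->; rewrite ?opprK; [right | left | left | right].
Qed.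

Definition switch G U : signed_graph T :=
  SignedGraph (@adj_sym _ G) (@adj_irr _ G)
    (switch_sign_sym G U) (@switch_sign_pm1 G U).

End SignedGraphs.

Definition sg_iso (T1 T2 : finType)
    (G : signed_graph T1) (H : signed_graph T2) : Prop :=
  exists f : T1 -> T2,
    [/\ bijective f,
        forall x y, adj H (f x) (f y) = adj G x y &
        forall x y, adj G x y -> sign H (f x) (f y) = sign G x y].

Definition switching_equiv (T1 T2 : finType)
    (G : signed_graph T1) (H : signed_graph T2) : Prop :=
  exists U : {set T1}, sg_iso (switch G U) H.

Section Spectrum.
Variables (R : realType) (n : nat).

Definition adjmx (G : signed_graph 'I_n) : 'M[R]_n :=
  \matrix_(i, j) (if adj G i j then (sign G i j)%:~R else 0).

(* Real eigenvalues listed with algebraic multiplicity, in nonincreasing order;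
   for a real symmetric matrix these are all the eigenvalues. *)
Definition eigenvalues (A : 'M[R]_n) : seq R :=
  sort >=%R
    (flatten [seq nseq (mup x (char_poly A)) x | x <- rootsR (char_poly A)]).

Lemma mem_eigenvalues (A : 'M[R]_n) a :
  (a \in eigenvalues A) = eigenvalue A a.
Proof.
have p0 : char_poly A != 0 by rewrite monic_neq0 ?char_poly_monic.
rewrite mem_sort eigenvalue_root_char.
apply/flatten_mapP/idP => [[x xp]|ra].
  rewrite mem_nseq => /andP[_ /eqP ->].
  by move: xp; rewrite -roots_on_rootsR // => /andP[].
exists a; first by rewrite -roots_on_rootsR // ra.
by rewrite mem_nseq eqxx andbT -XsubC_dvd // dvdp_XsubCl.
Qed.

Lemma eigenvalues_sorted (A : 'M[R]_n) : sorted >=%R (eigenvalues A).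
Proof. by apply: sort_sorted => x y; exact: le_total. Qed.

Definition lambda_max (A : 'M[R]_n) : R := head 0 (eigenvalues A).

Definition lambda_min (A : 'M[R]_n) : R := last 0 (eigenvalues A).

Definition spectral_radius (G : signed_graph 'I_n) : R :=
  Num.max (lambda_max (adjmx G)) (- lambda_min (adjmx G)).

End Spectrum.

Arguments spectral_radius R {n} G.

(* The vertices u_i, v_j, u, v of G^{s,t} are encoded as [inl (inl i)],
   [inl (inr j)], [inr true] and [inr false] respectively. *)
Section Gst.
Variables s t : nat.

Definition Gst_vertex : finType := ('I_s + 'I_t + bool)%type.

Definition Gst_adj (x y : Gst_vertex) : bool :=
  match x, y with
  | inl a, inl b => a != b
  | inr a, inr b => a != b
  | inl (inl _), inr b | inr b, inl (inl _) => b
  | inl (inr _), inr b | inr b, inl (inr _) => ~~ b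
  end.

Definition Gst_sign (x y : Gst_vertex) : int :=
  match x, y with
  | inr _, inr _ => -1
  | _, _ => 1
  end.

Lemma Gst_adj_sym : symmetric Gst_adj.
Proof. by move=> [[i|i]|i] [[j|j]|j] //=; rewrite eq_sym. Qed.

Lemma Gst_adj_irr : irreflexive Gst_adj.
Proof. by move=> [[i|i]|i] //=; rewrite eqxx. Qed.

Lemma Gst_sign_sym x y : Gst_sign x y = Gst_sign y x.
Proof. by case: x y => [x|x] [y|y]. Qed.

Lemma Gst_sign_pm1 x y :
  Gst_adj x y -> Gst_sign x y = 1 \/ Gst_sign x y = -1.
Proof. by case: x y => [x|x] [y|y] _; [left | left | left | right]. Qed.

Definition Gst : signed_graph Gst_vertex :=
  SignedGraph Gst_adj_sym Gst_adj_irr Gst_sign_sym Gst_sign_pm1.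

End Gst.

(* Main.v *)
Require Import Defs.
From HB Require Import structures.
From mathcomp Require Import all_boot all_order all_algebra.
From mathcomp Require Import reals ring lra zify.
Set Implicit Arguments.
Unset Strict Implicit.
Unset Printing Implicit Defensive.

Import Order.TTheory GRing.Theory Num.Theory.
Local Open Scope ring_scope.

(* Let [x] be an eigenvector for an eigenvalue [lam] of the adjacency matrix
   [a]. After switching, [x >= 0]. As the graph is unbalanced there is still a
   negative edge [uv], say with [x u <= x v]; as no triangle is negative, no
   vertex is joined positively to both [u] and [v]. If [x v = 0], then [x] lives
   on [n - 2] vertices and [lam <= n - 3]. Otherwise the eigenvalue equation at
   [u] provides a positive neighbour [w] of [u], and [x^T a x] is at most the
   value at [x] of the quadratic form of G^{1,n-3}, in which [v] takes over every
   vertex outside [u], [v], [w]. With t = n - 3, the bound [r] is the positive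
   root of r^2 = (t - 1) r + 2 t, and [r |x|^2] minus that form is an explicit
   sum of squares; following the equality case back gives G^{1,n-3}.

   For [- lam], all triangles of the negated graph are negative, so after
   switching its positive edges form a triangle-free graph and the
   Motzkin-Straus argument gives [- lam <= n / 2], which is smaller than the
   bound if [n >= 5]. If [n = 4], the graph is a negative 4-cycle, and so is its
   negation, to which the first part applies. *)

(** The variance identity. Nonnegativity of the left side is Cauchy-Schwarz for the sum over [A],
    and its vanishing forces [x] to be constant on [A]. *)
Lemma sum_sqr_deviation (R : realFieldType) (T : finType) (A : {set T})
    (x : T -> R) : (0 < #|A|)%N ->
  \sum_(i in A) (x i - (\sum_(j in A) x j) / #|A|%:R) ^+ 2 =
  \sum_(i in A) x i ^+ 2 - (\sum_(i in A) x i) ^+ 2 / #|A|%:R.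
Proof.
move=> A0; set S := \sum_(j in A) x j.
have t0 : #|A|%:R != 0 :> R by rewrite pnatr_eq0 -lt0n.
transitivity (\sum_(i in A)
    (x i ^+ 2 + (- 2 * (S / #|A|%:R) * x i + (S / #|A|%:R) ^+ 2))).
  by apply: eq_bigr => i _; ring.
by rewrite !big_split /= -mulr_sumr sumr_const -/S -mulr_natr; field.
Qed.

(** * Eigenvalue bounds from a nonnegative eigenvector *)

Section NonnegativeEigenvector.
Variables (R : realFieldType) (T : finType) (a : T -> T -> R) (x : T -> R).
Variables (lam : R).
Hypothesis a_sym : forall i j, a i j = a j i.
Hypothesis a_diag : forall i, a i i = 0.
Hypothesis a_val : forall i j, [\/ a i j = 0, a i j = 1 | a i j = -1].
Hypothesis x_ge0 : forall i, 0 <= x i.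
Hypothesis x_neq0 : exists i, x i != 0.
Hypothesis x_eigen : forall i, \sum_j a i j * x j = lam * x i.

Lemma sum_sqr_gt0 : 0 < \sum_i x i ^+ 2.
Proof.
have [i xi] := x_neq0.
rewrite (bigD1 i) //= ltr_pwDl ?exprn_even_gt0 //.
by apply: sumr_ge0 => j _; rewrite sqr_ge0.
Qed.

Lemma eigen_quadratic_form :
  \sum_i \sum_j a i j * x i * x j = lam * \sum_i x i ^+ 2.
Proof.
rewrite mulr_sumr; apply: eq_bigr => i _.
rewrite expr2 mulrA -x_eigen mulr_suml; apply: eq_bigr => j _; ring.
Qed.

Lemma a_le1 i j : a i j <= 1.
Proof. by case: (a_val i j) => ->; lra. Qed.

Lemma a_eq1 i j : 0 < a i j -> a i j = 1.
Proof. by case: (a_val i j) => -> //; rewrite ?ltxx // ltr0N1. Qed.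

(* Motzkin-Straus for triangle-free graphs: if [M] is the largest weighted
   degree, attained at [u], then the neighbourhood of [u] is independent and
   has weight [M], so the edges have total weight at most [M (S - M)]. *)
Lemma eigen_le_half_card :
  (forall i j k, a i j * a j k * a k i != 1) -> lam <= #|T|%:R / 2.
Proof.
move=> a_tri.
pose p i j : R := (a i j == 1)%:R.
have p_ge0 i j : 0 <= p i j by rewrite ler0n.
have ap i j : a i j <= p i j.
  by rewrite /p; case: (a_val i j) => ->; rewrite ?eqxx ?ler0n //=;
    case: eqP => /=; lra.
pose d i := \sum_j p i j * x j.
have [i0 _] := x_neq0.
pose u := [arg max_(i > i0) d i]%O.
have d_max i : d i <= d u by rewrite /u; case: arg_maxP => // k _; apply.
(* [C] marks the complement of the positive neighbourhood of [u]. That neighbourhood is independent,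
   so each positive edge has an end marked by [C]. *)
pose C i : R := (a u i != 1)%:R.
pose S := \sum_i x i.
have dC : \sum_i C i * x i = S - d u.
  apply/eqP; rewrite eq_sym subr_eq -big_split /=; apply/eqP.
  apply: eq_bigr => i _; rewrite /C /p -mulrDl.
  by case: (a u i == 1); rewrite /= ?(add0r, addr0) mul1r.
have pC i j : p i j <= (C i + C j) * p i j.
  rewrite /C /p; case: eqP => [ij|_]; last by rewrite mulr0.
  rewrite mulr1; case: eqP => [ui|_] /=; last by rewrite lerDl ler0n.
  case: eqP => [uj|_] /=; last by lra.
  by have := a_tri u i j; rewrite ui ij (a_sym j) uj !mulr1 eqxx.
have psym i j : p i j = p j i by rewrite /p a_sym.
have H : lam * \sum_i x i ^+ 2 <= 2 * \sum_i C i * x i * d i.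
  rewrite -eigen_quadratic_form.
  have -> : 2 * (\sum_i C i * x i * d i) =
      \sum_i \sum_j (C i + C j) * p i j * x i * x j.
    transitivity (\sum_i \sum_j C i * p i j * x i * x j +
                  \sum_i \sum_j C j * p i j * x i * x j).
      rewrite [X in _ + X]exchange_big /= mulr_natl mulr2n.
      congr (_ + _); apply: eq_bigr => i _; rewrite mulr_sumr;
        apply: eq_bigr => j _; rewrite ?(psym j i); ring.
    by rewrite -big_split; apply: eq_bigr => i _; rewrite -big_split /=;
      apply: eq_bigr => j _; ring.
  apply: ler_sum => i _; apply: ler_sum => j _.
  by do 2!apply: ler_wpM2r => //; apply: le_trans (ap i j) (pC i j).
have H2 : \sum_i C i * x i * d i <= d u * (S - d u).
  rewrite -dC mulr_sumr; apply: ler_sum => i _.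
  by rewrite mulrC ler_wpM2r ?mulr_ge0 ?ler0n.
have T0 : (0 < #|[set: T]|)%N by rewrite cardsT; apply/card_gt0P; exists i0.
have := sum_sqr_deviation x T0.
set V := \sum_(i in setT) _ => VE.
have : 0 <= V by apply: sumr_ge0 => *; rewrite sqr_ge0.
have inT : forall F : T -> R, \sum_(i in [set: T]) F i = \sum_i F i.
  by move=> F; apply: eq_bigl => i; rewrite inE.
move: T0; rewrite VE !inT -/S cardsT -(ltr0n R).
move: #|T|%:R => N N0; rewrite subr_ge0 ler_pdivrMr // => SN.
rewrite -(ler_pM2r sum_sqr_gt0); apply: (le_trans H).
(* With [M = d u], this is [4 * M * (S - M) <= S ^ 2]. Together with [S ^ 2 <= N * Q] it bounds
   [2 * M * (S - M)] by [N / 2 * Q]. *)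
have : 0 <= (S - 2 * d u) ^+ 2 by rewrite sqr_ge0.
move: H2 SN; rewrite -/S; move: (\sum_i x i ^+ 2) (\sum_i C i * _ * _) => Q Z; nra.
Qed.

(** * Comparison with the extremal form when no triangle is negative *)

Hypothesis a_tri : forall i j k, a i j * a j k * a k i != -1.

Variables (r t : R).
Hypothesis card_gt3 : (3 < #|T|)%N.
Hypothesis t_def : t + 3 = #|T|%:R.
Hypothesis r_gt0 : 0 < r.
Hypothesis r_root : r ^+ 2 = (t - 1) * r + 2 * t.

Lemma t_ge1 : 1 <= t.
Proof. by rewrite -(lerD2r 3) t_def -(natrD _ 1 3) ler_nat. Qed.

(** The polynomial [X ^ 2 - (t - 1) * X - 2 * t] takes the value [- t < 0] at [t], so its positive
    root lies beyond [t]. *)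
Lemma t_lt_r : t < r.
Proof. by have := t_ge1; have := r_gt0; have := r_root; nra. Qed.

(** The eigenvector lives on [t + 1] vertices, where the form is at most that of a complete graph;
    Cauchy-Schwarz gives [lam <= t]. *)
Lemma eigen_lt_of_two_zeros u v : u != v -> x u = 0 -> x v = 0 -> lam < r.
Proof.
move=> uv xu xv; apply: le_lt_trans t_lt_r.
pose A := ~: [set u; v].
have cA : #|A|%:R = t + 1 :> R.
  have := cardsC [set u; v]; rewrite cards2 uv /= -/A => E.
  by apply: (addrI 2); rewrite -(natrD _ 2) E; rewrite -t_def; ring.
have A0 : (0 < #|A|)%N by rewrite -(ltr0n R) cA; have := t_ge1; lra.
have sumA (F : T -> R) : F u = 0 -> F v = 0 -> \sum_i F i = \sum_(i in A) F i.
  move=> Fu Fv; rewrite (bigID (mem A)) /= [X in _ + X]big1 ?addr0 // => i.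
  by rewrite !inE negbK => /orP[] /eqP ->.
have := sum_sqr_deviation x A0.
set V := \sum_(i in _) _ => VE.
have : 0 <= V by apply: sumr_ge0 => *; rewrite sqr_ge0.
rewrite VE cA subr_ge0 ler_pdivrMr; last by have := t_ge1; lra.
move=> CS; rewrite -(ler_pM2r sum_sqr_gt0) -eigen_quadratic_form.
(* Entrywise comparison with the all-ones matrix minus the identity, valid because [x] is
   nonnegative. *)
have : \sum_i \sum_j a i j * x i * x j <=
       \sum_i \sum_j (x i * x j - (i == j)%:R * x i * x j).
  apply: ler_sum => i _; apply: ler_sum => j _; rewrite -mulrA.
  have := mulr_ge0 (x_ge0 i) (x_ge0 j).
  case: eqP => [->|_] /=; first by rewrite a_diag; lra.
  by have := a_le1 i j; nra.
move/le_trans; apply.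
have -> : \sum_i \sum_j (x i * x j - (i == j)%:R * x i * x j) =
   (\sum_i x i) ^+ 2 - \sum_i x i ^+ 2.
  rewrite expr2 mulr_suml -sumrB; apply: eq_bigr => i _.
  rewrite sumrB -mulr_sumr; congr (_ - _).
  rewrite (bigD1 i) //= eqxx big1 ?addr0 => [|j]; first by rewrite /=; ring.
  by rewrite eq_sym => /negPf ->; rewrite !mul0r.
by rewrite (sumA x) // (sumA (fun i => x i ^+ 2)) ?xu ?xv ?expr0n //; lra.
Qed.

(* [a] is the matrix of [Gst 1 t], where [w] stands for its vertex u_1. *)
Definition extremal_at u v w : Prop :=
  [/\ [/\ u != v, u != w & v != w], [/\ a u v = -1, a u w = 1 & a v w = 0],
      forall z, z \notin [set u; v; w] -> [/\ a u z = 0, a v z = 1 & a w z = 1]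
    & forall z z', z \notin [set u; v; w] -> z' \notin [set u; v; w] ->
        z != z' -> a z z' = 1].

Section Edge.
Variables u v w : T.
Hypothesis distinct : [/\ u != v, u != w & v != w].
Let O := ~: [set u; v; w].

Lemma sum_split3 (F : T -> R) :
  \sum_i F i = F u + F v + F w + \sum_(i in O) F i.
Proof.
have [uv uw vw] := distinct.
rewrite (bigD1 u) //= (bigD1 v) ?(eq_sym v u) //= (bigD1 w) /=; last first.
  by rewrite !(eq_sym w) uw.
rewrite !addrA; congr (_ + _); apply: eq_bigl => i.
by rewrite !inE !negb_or.
Qed.

Lemma card_others : #|O|%:R = t.
Proof.
have [uv uw vw] := distinct.
have := cardsC [set u; v; w]; rewrite -/O.
rewrite -setUA [X in (X + _)%N]cardsU1 !inE negb_or uv uw /= cards2 vw => E.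
by apply: (addrI 3); rewrite -(natrD _ 3) E -t_def; ring.
Qed.

Let S := \sum_(i in O) x i.

(* [r |x|^2 - x^T A x] is the defect of the extremal form, which is a sum of
   squares, plus the slack in comparing [A] with the extremal pattern. *)
Lemma spectral_gap_identity : a u v = -1 -> a u w = 1 ->
  2 * r * ((r - lam) * \sum_i x i ^+ 2) =
  2 * (r * x u - (x w - x v)) ^+ 2 + (r ^+ 2 - 2) * (x w - x v) ^+ 2
  + (r * (x v + x w) - 2 * S) ^+ 2
  + 2 * r * (r + 1) * (\sum_(z in O) (x z - S / t) ^+ 2)
  + 2 * r * (2 * (- a v w * x v * x w)
    + 2 * (\sum_(z in O) x z * (x v - a u z * x u - a v z * x v))
    + 2 * (\sum_(z in O) x z * x w * (1 - a w z))
    + \sum_(z in O) \sum_(z' in O) ((z != z')%:R - a z z') * x z * x z').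
Proof.
move=> auv auw.
have cO := card_others.
have t0 : t != 0 by have := t_ge1; lra.
have O0 : (0 < #|O|)%N by rewrite -(ltr0n R) cO; have := t_ge1; lra.
have := sum_sqr_deviation x O0; rewrite cO -/S => ->.
rewrite mulrBl -eigen_quadratic_form.
pose Su := \sum_(z in O) x z * a u z.
pose Sv := \sum_(z in O) x z * a v z.
pose Sw := \sum_(z in O) x z * a w z.
pose SS := \sum_(z in O) \sum_(z' in O) a z z' * x z * x z'.
pose N := \sum_(z in O) x z ^+ 2.
have E1 : \sum_(z in O) x z * (x v - a u z * x u - a v z * x v) =
    S * x v - Su * x u - Sv * x v.
  rewrite /S /Su /Sv !mulr_suml -!sumrB; apply: eq_bigr => z _; ring.
have E2 : \sum_(z in O) x z * x w * (1 - a w z) = S * x w - Sw * x w.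
  rewrite /S /Sw !mulr_suml -!sumrB; apply: eq_bigr => z _; ring.
have E3 : \sum_(z in O) \sum_(z' in O) ((z != z')%:R - a z z') * x z * x z' =
    S ^+ 2 - N - SS.
  rewrite expr2 {1}/S mulr_suml -!sumrB; apply: eq_bigr => z zO.
  transitivity (\sum_(z' in O) (x z * x z' - (z == z')%:R * x z * x z'
                  - a z z' * x z * x z')).
    by apply: eq_bigr => z' _; case: eqP => _ /=; ring.
  rewrite !sumrB -mulr_sumr -/S; congr (_ - _ - _).
  rewrite (bigD1 z) //= eqxx big1 ?addr0 => [|j]; first by rewrite /=; ring.
  by rewrite eq_sym => /andP[_ /negPf ->]; rewrite !mul0r.
have E4 : \sum_i \sum_j a i j * x i * x j =
    - 2 * x u * x v + 2 * x u * x w + 2 * a v w * x v * x w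
    + 2 * (Su * x u + Sv * x v + Sw * x w) + SS.
  rewrite sum_split3 !(sum_split3 (fun j => a _ j * _ * x j)).
  have -> : \sum_(i in O) \sum_j a i j * x i * x j =
     Su * x u + Sv * x v + Sw * x w + SS.
    rewrite /Su /Sv /Sw /SS !mulr_suml -!big_split; apply: eq_bigr => z _ /=.
    by rewrite sum_split3 !(a_sym z); congr (_ + _); ring.
  have row y : \sum_(i in O) a y i * x y * x i =
      (\sum_(z in O) x z * a y z) * x y.
    by rewrite mulr_suml; apply: eq_bigr => z _; ring.
  rewrite !row -/Su -/Sv -/Sw !a_diag !(a_sym v u) !(a_sym w) auv auw; ring.
rewrite E1 E2 E3 E4 (sum_split3 (fun i => x i ^+ 2)) -/N.
(* The defining equation of [r], written as [r * (r + 1) = t * (r + 2)], clears the denominator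
   [t]. *)
have r2t : S ^+ 2 / t * (2 * r * (r + 1)) = S ^+ 2 * (2 * r + 4).
  have -> : 2 * r * (r + 1) = t * (2 * r + 4) by have := r_root; nra.
  by field.
transitivity (2 * (r * x u - (x w - x v)) ^+ 2 + (r ^+ 2 - 2) * (x w - x v) ^+ 2
  + (r * (x v + x w) - 2 * S) ^+ 2
  + (2 * r * (r + 1) * N - S ^+ 2 / t * (2 * r * (r + 1)))
  + 2 * r * (2 * (- a v w * x v * x w)
    + 2 * (S * x v - Su * x u - Sv * x v)
    + 2 * (S * x w - Sw * x w) + (S ^+ 2 - N - SS))).
  rewrite r2t; ring.
by ring.
Qed.

(** The triangle condition and [x u <= x v] make every summand of the gap identity nonnegative,
    which excludes [lam > r]. If [lam = r], all of them vanish, and the entries of [a] are read off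
    once the relevant entries of [x] are known to be positive. *)
Lemma eigen_le_at : a u v = -1 -> a u w = 1 -> x u <= x v -> 0 < x v ->
  lam < r \/ lam = r /\ extremal_at u v w.
Proof.
move=> auv auw xuv xv0.
have [uv uw vw] := distinct.
have tge1 := t_ge1.
have avw : a v w <= 0.
  rewrite leNgt; apply/negP => /a_eq1 E.
  by have := a_tri u v w; rewrite auv E (a_sym w) auw !mulr1 eqxx.
have uvz z : ~ (a u z = 1 /\ a v z = 1).
  move=> [uz vz]; have := a_tri u v z.
  by rewrite auv vz (a_sym z) uz !mulr1 eqxx.
have := spectral_gap_identity auv auw.
set d0 := (_ - (_ - _)) ^+ 2.
set d1 := (_ - _) ^+ 2.
set d2 := (_ - 2 * _) ^+ 2.
set d3 := \sum_(z in O) (_ - _) ^+ 2.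
set d4 := - _ * _ * _.
set d5 := \sum_(z in O) _ * (_ - _ - _).
set d6 := \sum_(z in O) _ * _ * (1 - _).
set d7 := \sum_(z in O) \sum_(z' in O) _ => gap.
have d0_ge0 : 0 <= d0 by rewrite sqr_ge0.
have d1_ge0 : 0 <= d1 by rewrite sqr_ge0.
have d2_ge0 : 0 <= d2 by rewrite sqr_ge0.
have d3s z : z \in O -> 0 <= (x z - S / t) ^+ 2 by rewrite sqr_ge0.
have d3_ge0 : 0 <= d3 by apply: sumr_ge0.
have d4_ge0 : 0 <= d4 by rewrite /d4 !mulr_ge0 // oppr_ge0.
(* At most one of [a u z] and [a v z] equals 1, and [x u <= x v], so together they contribute at
   most [x v]. *)
have d5s z : z \in O -> 0 <= x z * (x v - a u z * x u - a v z * x v).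
  move=> _; apply: mulr_ge0 => //; have := x_ge0 u; have := uvz z.
  by case: (a_val u z) => ->; case: (a_val v z) => -> // H; try lra; case: H.
have d5_ge0 : 0 <= d5 by apply: sumr_ge0.
have d6s z : z \in O -> 0 <= x z * x w * (1 - a w z).
  by move=> _; rewrite !mulr_ge0 // subr_ge0 a_le1.
have d6_ge0 : 0 <= d6 by apply: sumr_ge0.
have d7ss z : z \in O -> forall z', z' \in O ->
    0 <= ((z != z')%:R - a z z') * x z * x z'.
  move=> _ z' _; rewrite !mulr_ge0 // subr_ge0; case: eqP => [->|_] /=.
    by rewrite a_diag.
  exact: a_le1.
have d7s z : z \in O ->
    0 <= \sum_(z' in O) ((z != z')%:R - a z z') * x z * x z'.
  by move=> zO; apply: sumr_ge0; apply: d7ss.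
have d7_ge0 : 0 <= d7 by apply: sumr_ge0.
have r2 : 2 <= r ^+ 2 by have := r_root; have := r_gt0; nra.
have g1 : 0 <= (r ^+ 2 - 2) * d1 by rewrite mulr_ge0 // subr_ge0.
have g3 : 0 <= r * (r + 1) * d3 by rewrite !mulr_ge0 //; have := r_gt0; lra.
have g4 : 0 <= r * d4 by rewrite mulr_ge0 // ltW.
have g5 : 0 <= r * d5 by rewrite mulr_ge0 // ltW.
have g6 : 0 <= r * d6 by rewrite mulr_ge0 // ltW.
have g7 : 0 <= r * d7 by rewrite mulr_ge0 // ltW.
have [|lr|E] := ltgtP lam r; [by left | | right; split=> //].
  have := sum_sqr_gt0; move: (\sum_i x i ^+ 2) gap => Q gap Q0.
  have : 0 < r * ((lam - r) * Q) by rewrite !mulr_gt0 // subr_gt0.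
  lra.
move: gap; rewrite E subrr mul0r mulr0 => gap.
have z0 : d0 = 0 by lra.
(* The coefficient is kept: it vanishes when [t = 1], so [d1 = 0] does not follow in general. *)
have z1 : (r ^+ 2 - 2) * d1 = 0 by lra.
have z2 : d2 = 0 by lra.
have cancel_r y : r * y = 0 -> y = 0.
  by move/eqP; rewrite mulf_eq0 (gt_eqF r_gt0) => /eqP.
have z3 : d3 = 0.
  have /eqP : r * (r + 1) * d3 = 0 by lra.
  rewrite !mulf_eq0 (gt_eqF r_gt0) gt_eqF /=; first by move/eqP.
  by have := r_gt0; lra.
have z4 : d4 = 0 by apply: cancel_r; lra.
have z5 : d5 = 0 by apply: cancel_r; lra.
have z6 : d6 = 0 by apply: cancel_r; lra.
have z7 : d7 = 0 by apply: cancel_r; lra.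
have xw : x w = x v + r * x u.
  by move/eqP: z0; rewrite /d0 sqrf_eq0 => /eqP; lra.
have xw0 : 0 < x w.
  by rewrite xw ltr_pwDl // mulr_ge0 // ltW.
have S0 : 0 < S.
  move/eqP: z2; rewrite /d2 sqrf_eq0 => /eqP.
  have : 0 < r * (x v + x w) by rewrite mulr_gt0 // addr_gt0.
  lra.
have xO z : z \in O -> x z = S / t.
  move=> zO; move/eqP: z3; rewrite psumr_eq0 // => /allP /(_ z).
  by rewrite mem_index_enum zO sqrf_eq0 subr_eq0 => /(_ isT) /eqP.
have xO0 z : z \in O -> 0 < x z.
  by move=> /xO ->; rewrite divr_gt0 //; lra.
have awz z : z \in O -> a w z = 1.
  move=> zO; move/eqP: z6; rewrite psumr_eq0 // => /allP /(_ z).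
  rewrite mem_index_enum zO !mulf_eq0 (gt_eqF xw0) (gt_eqF (xO0 z zO)) => /(_ isT).
  by rewrite subr_eq0 eq_sym => /eqP.
have avw0 : a v w = 0.
  move/eqP: z4; rewrite /d4 !mulf_eq0 (gt_eqF xw0) (gt_eqF xv0) !orbF oppr_eq0.
  by move/eqP.
have azz z z' : z \in O -> z' \in O -> z != z' -> a z z' = 1.
  move=> zO z'O zz'; move/eqP: z7; rewrite psumr_eq0 // => /allP /(_ z).
  rewrite mem_index_enum zO => /(_ isT) /=; rewrite psumr_eq0; last exact: d7ss.
  move=> /allP /(_ z'); rewrite mem_index_enum z'O => /(_ isT) /=.
  rewrite zz' !mulf_eq0 (gt_eqF (xO0 z zO)) (gt_eqF (xO0 z' z'O)) !orbF.
  rewrite subr_eq0 eq_sym.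
  by move/eqP.
have avz z : z \in O -> a v z = 1.
  move=> zO; move/eqP: z5; rewrite psumr_eq0 // => /allP /(_ z).
  rewrite mem_index_enum zO !mulf_eq0 (gt_eqF (xO0 z zO)) => /(_ isT) /eqP H.
  (* If [a v z <= 0], the vanishing slack at [z] forces [x u = x v]. Then [x w - x v = r * x v] is
     nonzero, so [r ^ 2 = 2] and [t = 1]. Now [z] is the only vertex of [O], and the eigenvalue
     equation at [v] has a negative left side and a positive right side. *)
  case: (ltP 0 (a v z)) => [/a_eq1 //|avz].
  have xu : x u = x v.
    apply/eqP; rewrite eq_le xuv /=.
    have : a v z * x v <= 0 by rewrite mulr_le0_ge0 // ltW.
    by have := a_le1 u z; have := x_ge0 u; nra.
  have t1 : t = 1.
    move/eqP: z1; rewrite /d1 mulf_eq0 sqrf_eq0 (_ : x w - x v = r * x v); last first.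
      by rewrite xw xu; ring.
    rewrite mulf_eq0 (gt_eqF r_gt0) (gt_eqF xv0) !orbF => /eqP.
    by have := r_root; have := r_gt0; nra.
  have O1 : O = [set z].
    apply/esym/eqP; rewrite eqEcard sub1set zO cards1 /=.
    by rewrite -(ler_nat R) card_others t1.
  have := x_eigen v; rewrite sum_split3 O1 big_set1 a_diag avw0 (a_sym v u) auv E.
  have : a v z * x z <= 0 by rewrite mulr_le0_ge0.
  have : 0 < r * x v by rewrite mulr_gt0.
  by rewrite xu; lra.
have notO z : z \notin [set u; v; w] -> z \in O by rewrite !inE.
split=> // [z /notO zO|z z' /notO zO /notO z'O]; last exact: azz.
split; [|exact: avz|exact: awz].
(* The value 1 would make [z] a common positive neighbour of [u] and [v]; the value -1 would make
   [u], [w], [z] a negative triangle. *)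
case: (a_val u z) => // uz.
  by case: (uvz z); split=> //; exact: avz.
have := a_tri u w z; rewrite auw awz // (a_sym z) uz !mul1r eqxx //.
Qed.

End Edge.

Lemma eigen_le_extremal : (exists u v, a u v = -1) ->
  lam < r \/ lam = r /\ exists u v w, extremal_at u v w.
Proof.
case=> u' [v' auv'].
have [u [v [auv xuv]]] : exists u v, a u v = -1 /\ x u <= x v.
  have [le|/ltW le] := leP (x u') (x v'); first by exists u', v'.
  by exists v', u'; rewrite a_sym.
have uv : u != v.
  by apply/eqP => E; move: auv; rewrite E a_diag; lra.
have := x_ge0 v; rewrite le_eqVlt => /orP[/eqP xv|xv].
  left; apply: (eigen_lt_of_two_zeros uv) => //; apply/eqP.
  by rewrite eq_le x_ge0 andbT xv.
have [lam0|lam0] := ltP lam 0; first by left; apply: lt_trans r_gt0.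
have [w auw] : exists w, a u w = 1.
  have [/existsP[w /eqP]|/existsPn none] := boolP [exists w, a u w == 1].
    by exists w.
  (* Without a positive neighbour of [u], the equation at [u] has only nonpositive terms, one of
     them [- x v < 0], against [lam >= 0]. *)
  have : lam * x u <= - x v.
    rewrite -x_eigen (bigD1 v) //= auv mulN1r gerDl; apply: sumr_le0 => z _.
    rewrite mulr_le0_ge0 //.
    by case: (a_val u z) (none z) => -> //; rewrite ?eqxx // lerN10.
  by have := mulr_ge0 lam0 (x_ge0 u); lra.
have uw : u != w by apply/eqP => E; move: auw; rewrite E a_diag; lra.
have vw : v != w by apply/eqP => E; move: auw; rewrite -E auv; lra.
have [||[? ?]] := @eigen_le_at u v w _ auv auw xuv xv; [by []|by left|].
by right; split=> //; exists u, v, w.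
Qed.

End NonnegativeEigenvector.

(** * Switching, cycle signs and negation of signed graphs *)

Section SignedGraphLemmas.
Variable T : finType.
Implicit Types (G : signed_graph T) (U : {set T}).

(** The integer adjacency matrix. With 0 off the edges, isomorphism and switching become equations
    valid for all pairs, whereas [sign] is arbitrary on non-adjacent ones. *)
Definition edge_val G x y : int := if adj G x y then sign G x y else 0.

Lemma edge_val_sym G x y : edge_val G x y = edge_val G y x.
Proof. by rewrite /edge_val adj_sym sign_sym. Qed.

Lemma edge_val_diag G x : edge_val G x x = 0.
Proof. by rewrite /edge_val adj_irr. Qed.

Lemma edge_val_cases G x y :
  [\/ edge_val G x y = 0, edge_val G x y = 1 | edge_val G x y = -1].
Proof.
rewrite /edge_val; case: ifP => [/sign_pm1[]->|_]; by constructor.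
Qed.

Lemma adj_edge_val G x y : adj G x y = (edge_val G x y != 0).
Proof.
by rewrite /edge_val; case: ifP => [/sign_pm1[]->|_]; rewrite ?eqxx.
Qed.

(** Diagonal of the sign matrix that conjugates the adjacency matrix when switching at [U]. *)
Definition switch_factor U x : int := if x \in U then -1 else 1.

Lemma switch_factor_sqr U x : switch_factor U x * switch_factor U x = 1.
Proof. by rewrite /switch_factor; case: ifP. Qed.

Lemma switch_signE G U x y :
  switch_sign G U x y = switch_factor U x * switch_factor U y * sign G x y.
Proof.
rewrite /switch_sign /switch_factor.
by case: (x \in U); case: (y \in U); rewrite /= ?mulN1r ?mul1r ?opprK ?mul1r.
Qed.

Lemma edge_val_switch G U x y :
  edge_val (switch G U) x y =
  switch_factor U x * switch_factor U y * edge_val G x y.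
Proof. by rewrite /edge_val /= switch_signE; case: ifP; rewrite ?mulr0. Qed.

Lemma edge_val_unswitch G U x y :
  edge_val G x y =
  switch_factor U x * switch_factor U y * edge_val (switch G U) x y.
Proof.
rewrite edge_val_switch mulrA mulrACA !switch_factor_sqr.
by rewrite !mul1r.
Qed.

(** Each vertex of the cycle contributes its factor twice, once as the start and once as the end of
    an edge, because [next c] permutes [c]. *)
Lemma cycle_sign_switch G U c : uniq c ->
  cycle_sign (switch G U) c = cycle_sign G c.
Proof.
move=> Uc; rewrite /cycle_sign.
under eq_bigr => x _ do rewrite /= switch_signE.
rewrite !big_split /= -[RHS]mul1r; congr (_ * _).
have next_perm : perm_eq (map (next c) c) c.
  have Um : uniq (map (next c) c).
    by rewrite map_inj_uniq //; exact: can_inj (prev_next Uc).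
  apply: uniq_perm => //.
  apply: (uniq_min_size Um _ _).2; last by rewrite size_map.
  by move=> _ /mapP[x xc ->]; rewrite mem_next.
rewrite -(big_map (next c) predT (switch_factor U)) (perm_big _ next_perm) /=.
by rewrite -big_split /= big1 // => x _; rewrite switch_factor_sqr.
Qed.

Lemma unbalanced_switch G U : unbalanced G -> unbalanced (switch G U).
Proof.
move=> [c [Hc sc]]; exists c; split=> //.
by rewrite cycle_sign_switch //; case/and3P: Hc.
Qed.

Lemma C3neg_free_switch G U : C3neg_free G -> C3neg_free (switch G U).
Proof.
move=> free [c [Hc s3 sc]]; apply: free; exists c; split=> //.
by rewrite -sc cycle_sign_switch //; case/and3P: Hc.
Qed.

Lemma unbalanced_neg_edge G : unbalanced G -> exists u v, edge_val G u v = -1.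
Proof.
move=> [c [/and3P[_ Uc Cc] sc]].
have [/existsP[u /existsP[v /eqP uv]]|none] :=
  boolP [exists u, exists v, edge_val G u v == -1]; first by exists u, v.
move: sc; rewrite /cycle_sign big_seq big1 // => x xc.
have axn := next_cycle Cc xc.
move/existsPn/(_ x)/existsPn/(_ (next c x)): none.
by rewrite /edge_val axn; case: (sign_pm1 axn) => ->.
Qed.

Lemma triangle_sign G x y z : C3neg_free G ->
  adj G x y -> adj G y z -> adj G z x ->
  sign G x y * sign G y z * sign G z x = 1.
Proof.
move=> free xy yz zx.
have neq a b : adj G a b -> (a == b) = false.
  by move=> ab; apply/eqP => E; move: ab; rewrite E adj_irr.
have nxy := neq _ _ xy; have nyz := neq _ _ yz; have nzx := neq _ _ zx.
have : sign G x y * sign G y z * sign G z x != -1.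
  apply/eqP => E; apply: free; exists [:: x; y; z]; split=> //.
    by rewrite /is_cycle /= xy yz zx !inE nxy nyz (eq_sym x) nzx.
  rewrite /cycle_sign !big_cons big_nil /= !eqxx.
  by rewrite (eq_sym y x) nxy nzx (eq_sym z y) nyz mulr1 mulrA.
by case: (sign_pm1 xy) => ->; case: (sign_pm1 yz) => ->;
   case: (sign_pm1 zx) => ->.
Qed.

Lemma edge_val_triangle G x y z : C3neg_free G ->
  edge_val G x y * edge_val G y z * edge_val G z x != -1.
Proof.
move=> free; rewrite /edge_val.
case: ifP => xy; last by rewrite !mul0r.
case: ifP => yz; last by rewrite mulr0 mul0r.
by case: ifP => zx; rewrite ?mulr0 // triangle_sign.
Qed.

Lemma C3neg_free_unbalanced_size G c : C3neg_free G -> is_cycle G c ->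
  cycle_sign G c = -1 -> (3 < size c)%N.
Proof.
move=> free Hc sc; have /and3P[c3 _ _] := Hc.
rewrite ltn_neqAle c3 andbT; apply/eqP => E.
by apply: free; exists c.
Qed.

Lemma card_gt3 G : unbalanced G -> C3neg_free G -> (3 < #|T|)%N.
Proof.
move=> [c [Hc sc]] free; have /and3P[_ Uc _] := Hc.
apply: leq_trans (C3neg_free_unbalanced_size free Hc sc) _.
by rewrite -(card_uniqP Uc) max_card.
Qed.

Fact opp_sign_sym G x y : - sign G x y = - sign G y x.
Proof. by rewrite sign_sym. Qed.

Fact opp_sign_pm1 G x y : adj G x y -> - sign G x y = 1 \/ - sign G x y = -1.
Proof. by move=> /sign_pm1[]->; rewrite ?opprK; [right|left]. Qed.

Definition opp_graph G : signed_graph T :=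
  SignedGraph (@adj_sym _ G) (@adj_irr _ G)
    (opp_sign_sym G) (@opp_sign_pm1 G).

Lemma edge_val_opp G x y : edge_val (opp_graph G) x y = - edge_val G x y.
Proof. by rewrite /edge_val /=; case: ifP; rewrite ?oppr0. Qed.

(** A negative cycle has length 4 and visits every vertex; negating four signs preserves its sign. A
    chord would cut it into two triangles whose signs multiply to that of the cycle, so one of them
    would be negative. *)
Lemma card4_cycle G : #|T| = 4 -> unbalanced G -> C3neg_free G ->
  unbalanced (opp_graph G) /\
  forall x y z, adj G x y -> adj G y z -> adj G z x -> False.
Proof.
move=> T4 [c [Hc sc]] free.
have c4 : size c = 4.
  apply/eqP; rewrite eqn_leq (C3neg_free_unbalanced_size free Hc sc) andbT -T4.
  by have /and3P[_ Uc _] := Hc; rewrite -(card_uniqP Uc) max_card.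
have opp_c : cycle_sign (opp_graph G) c = -1.
  rewrite -sc /cycle_sign /=; move: c4 => {Hc sc}.
  under eq_bigr do rewrite -mulN1r.
  rewrite big_split /= big_const_seq count_predT => ->.
  by rewrite -[RHS]mul1r.
split; first by exists c.
move: (Hc); have /and3P[_ Uc _] := Hc.
(* A vertex off the cycle would give five distinct elements of [T]. *)
have inT x : x \in c.
  apply/negPn/negP => xc; have : uniq (x :: c) by rewrite /= xc.
  by move/card_uniqP => E; have := max_card (mem (x :: c)); rewrite E /= c4 T4.
move: c c4 {Hc opp_c} sc Uc inT => [|p [|q [|r [|s []]]]] //= _.
rewrite /cycle_sign !big_cons big_nil /= !eqxx !inE !negb_or.
move=> + /and4P[/and3P[pq pr ps] /andP[qr qs] rs _] inT.
rewrite /is_cycle /= !andbT.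
rewrite (eq_sym q p) (eq_sym r p) (eq_sym r q).
rewrite (eq_sym s p) (eq_sym s q) (eq_sym s r).
rewrite (negPf pq) (negPf pr) (negPf ps) (negPf qr) (negPf qs) (negPf rs).
move=> sc /andP[_ /and4P[apq aqr ars asp]].
have npr : adj G p r = false.
  apply/negP => apr.
  have := triangle_sign free apq aqr; rewrite adj_sym => /(_ apr) t1.
  have := triangle_sign free apr ars asp => t2.
  have := congr2 *%R t1 t2; move: sc; rewrite (sign_sym G r p).
  by case: (sign_pm1 apq) (sign_pm1 aqr) (sign_pm1 ars) (sign_pm1 asp)
    (sign_pm1 apr) => -> [] -> [] -> [] -> [] ->.
have nqs : adj G q s = false.
  apply/negP => aqs.
  have := triangle_sign free aqr ars; rewrite adj_sym => /(_ aqs) t1.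
  have := triangle_sign free aqs asp apq => t2.
  have := congr2 *%R t1 t2; move: sc; rewrite (sign_sym G s q).
  by case: (sign_pm1 apq) (sign_pm1 aqr) (sign_pm1 ars) (sign_pm1 asp)
    (sign_pm1 aqs) => -> [] -> [] -> [] -> [] ->.
have nrp : adj G r p = false by rewrite adj_sym.
have nsq : adj G s q = false by rewrite adj_sym.
move=> x y z.
have := inT x; have := inT y; have := inT z; rewrite !inE.
by case/or4P => /eqP ->; case/or4P => /eqP ->; case/or4P => /eqP ->;
  rewrite ?adj_irr ?npr ?nqs ?nrp ?nsq.
Qed.

Lemma card4_opp G : #|T| = 4 -> unbalanced G -> C3neg_free G ->
  unbalanced (opp_graph G) /\ C3neg_free (opp_graph G).
Proof.
move=> T4 unb free; have [opp_unb no_tri] := card4_cycle T4 unb free.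
split=> // -[c [Hc c3 _]].
move: c c3 Hc => [|x [|y [|z []]]] // _ /and3P[_ _ /= /and4P[xy yz zx _]].
exact: (no_tri x y z).
Qed.

End SignedGraphLemmas.

(** * Isomorphisms and the extremal graph *)

Lemma sg_iso_edge_val (T1 T2 : finType) (G : signed_graph T1)
    (H : signed_graph T2) (f : T1 -> T2) : bijective f ->
  (forall x y, edge_val H (f x) (f y) = edge_val G x y) -> sg_iso G H.
Proof.
move=> bf Hf; exists f; split=> // x y; first by rewrite !adj_edge_val Hf.
move=> xy; have := Hf x y; rewrite /edge_val xy.
by rewrite [adj H _ _]adj_edge_val Hf -adj_edge_val xy.
Qed.

Lemma edge_val_sg_iso (T1 T2 : finType) (G : signed_graph T1)
    (H : signed_graph T2) : sg_iso G H ->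
  exists2 f : T1 -> T2, bijective f &
    forall x y, edge_val H (f x) (f y) = edge_val G x y.
Proof.
move=> [f [bf Ha Hs]]; exists f => // x y.
by rewrite /edge_val Ha; case: ifP => // /Hs.
Qed.

(* All edges of the 4-cycle cross the bipartition [{u, v_1}], [{u_1, v}], so
   switching there negates every sign. *)
Lemma switching_equiv_opp (T : finType) (G : signed_graph T) :
  switching_equiv (opp_graph G) (Gst 1 1) -> switching_equiv G (Gst 1 1).
Proof.
move=> [U /edge_val_sg_iso[f bf Hf]].
pose side (p : Gst_vertex 1 1) :=
  match p with inl (inl _) => false | inl (inr _) => true | inr b => b end.
(* The symmetric difference realizes switching at [U] followed by switching at one side of the
   bipartition. *)
exists [set x | (x \in U) (+) side (f x)].
apply: (sg_iso_edge_val bf) => x y.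
rewrite edge_val_switch [in RHS](edge_val_unswitch G U).
have := Hf x y; rewrite edge_val_switch edge_val_opp edge_val_switch.
have : edge_val (Gst 1 1) (f x) (f y) != 0 -> side (f x) != side (f y).
  rewrite /edge_val /=; case: (f x) (f y) => [[i|i]|[]] [[j|j]|[]] //=;
  by rewrite (ord1 i) (ord1 j) eqxx.
move: (edge_val (Gst _ _) _ _) (edge_val G x y) => e g.
rewrite /switch_factor !inE.
case: (x \in U); case: (y \in U); case: (side (f x)); case: (side (f y)) => //=;
 case: (eqVneq e 0) => [->|e0 H]; lia.
Qed.

(** With [t = m.+1], the value 0 at [u] makes the contributions of [v] and [u_1] there cancel. The
    equations at [u_1] and [v] both read [t * r = r * t], and the one at each [v_j] is the quadratic
    equation of [r]. *)
Definition Gst_eigenvector (R : realType) (m : nat) (r : R)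
    (p : Gst_vertex 1 m.+1) : R :=
  match p with
  | inr b => if b then 0 else m.+1%:R
  | inl (inl _) => m.+1%:R
  | inl (inr _) => r
  end.

Lemma Gst_eigen (R : realType) (m : nat) (r : R) p :
  r ^+ 2 = m%:R * r + 2 * m.+1%:R ->
  \sum_q (edge_val (Gst 1 m.+1) p q)%:~R * Gst_eigenvector r q =
  r * Gst_eigenvector r p.
Proof.
move=> r_root; rewrite !big_sumType big_bool big_ord1 /edge_val /=.
case: p => [[i|j]|b] /=.
- rewrite (ord1 i) /= sumr_const card_ord -mulr_natl; ring.
- rewrite (bigD1 j) //= eqxx /=.
  under eq_bigr => k kj do rewrite /eq_op /= eq_sym kj.
  rewrite sumr_const cardC1 card_ord -mulr_natl.
  by rewrite -[r * r]expr2 r_root; ring.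
- case: b => /=.
    rewrite big1 => [|i _]; last by rewrite mul0r.
    by rewrite mulrN1z !mul0r mulr0 mul1r mulN1r addr0 add0r subrr.
  by rewrite sumr_const card_ord !mul0r mulr0 mul1r !addr0 add0r mulr_natr.
Qed.

Lemma extremal_sg_iso (R : realType) (m : nat) (H : signed_graph 'I_m.+4)
    (u v w : 'I_m.+4) :
  extremal_at (fun i j => (edge_val H i j)%:~R : R) u v w ->
  sg_iso H (Gst 1 m.+1).
Proof.
move=> [[uv uw vw] [huv huw hvw] hO hOO].
have toZ (z : int) : [/\ z%:~R = 0 :> R -> z = 0, z%:~R = 1 :> R -> z = 1
    & z%:~R = -1 :> R -> z = -1].
  split=> /eqP.
  - by rewrite intr_eq0 => /eqP.
  - by rewrite -[X in _ == X]/(1%:~R) eqr_int => /eqP.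
  - by rewrite -[X in _ == X]mulrN1z eqr_int => /eqP.
have to0 z := let: And3 h _ _ := toZ z in h.
have to1 z := let: And3 _ h _ := toZ z in h.
have toN1 z := let: And3 _ _ h := toZ z in h.
move/toN1: huv => huv; move/to1: huw => huw; move/to0: hvw => hvw.
pose O := ~: [set u; v; w].
have cO : #|O| = m.+1.
  have := cardsC [set u; v; w]; rewrite -/O card_ord.
  rewrite -setUA [X in (X + _)%N]cardsU1 !inE negb_or uv uw /= cards2 vw.
  by lia.
(* The vertices of [O] are numbered by their position in [enum O]; these positions are below [m.+1],
   so [inord] preserves them. *)
pose f (i : 'I_m.+4) : Gst_vertex 1 m.+1 :=
  if i == u then inr true else if i == v then inr false else
  if i == w then inl (inl ord0) else inl (inr (inord (index i (enum O)))).
have fu : f u = inr true by rewrite /f eqxx.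
have fv : f v = inr false by rewrite /f eq_sym (negPf uv) eqxx.
have fw : f w = inl (inl ord0).
  by rewrite /f eq_sym (negPf uw) eq_sym (negPf vw) eqxx.
have fO i : i \in O -> f i = inl (inr (inord (index i (enum O)))).
  by rewrite !inE /f !negb_or => /andP[/andP[/negPf-> /negPf->] /negPf->].
have cases i : [\/ i = u, i = v, i = w | i \in O].
  have [iO|] := boolP (i \in O); first by constructor 4.
  by rewrite !inE negbK => /orP[/orP[]|] /eqP ->; constructor.
have idx i : i \in O -> (index i (enum O) < m.+1)%N.
  by move=> iO; rewrite -[X in (_ < X)%N]cO cardE index_mem mem_enum.
have inj_idx i j : i \in O -> j \in O ->
    (inord (index i (enum O)) == inord (index j (enum O)) :> 'I_m.+1) = (i == j).
  move=> iO jO; apply/eqP/eqP => [|-> //] /(congr1 val) /=.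
  rewrite !inordK ?idx // => E.
  rewrite -(nth_index u (s := enum O) (x := i)) ?mem_enum // E.
  by rewrite nth_index ?mem_enum.
have f_inj : injective f.
  move=> i j.
  case: (cases i) (cases j) => [->|->|->|iO] [->|->|->|jO];
    rewrite ?fu ?fv ?fw ?fO // => -[] /eqP; rewrite inj_idx // => /eqP //.
have f_bij : bijective f.
  apply: inj_card_bij => //.
  by rewrite !card_sum card_bool !card_ord; lia.
have notO i : i \in O -> i \notin [set u; v; w] by rewrite in_setC.
apply: (sg_iso_edge_val f_bij) => i j.
have oO k : k \in O -> [/\ edge_val H u k = 0, edge_val H v k = 1
    & edge_val H w k = 1].
  by move=> /notO/hO[/to0 ? /to1 ? /to1 ?].
case: (cases i) (cases j) => [->|->|->|iO] [->|->|->|jO];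
  rewrite ?fu ?fv ?fw ?fO // ?edge_val_diag //
    ?(edge_val_sym H v u) ?(edge_val_sym H w u) ?(edge_val_sym H w v)
    ?huv ?huw ?hvw //;
  try (by case: (oO _ jO) => h1 h2 h3; rewrite ?h1 ?h2 ?h3);
  try (by case: (oO _ iO) => h1 h2 h3;
    rewrite ?(edge_val_sym H i) ?h1 ?h2 ?h3).
rewrite {1}/edge_val /= /eq_op /= inj_idx //.
have [->|ij] := eqVneq i j; first by rewrite edge_val_diag.
by have /to1 -> := hOO i j (notO _ iO) (notO _ jO) ij.
Qed.

(** * Spectral bounds for signed graphs *)

Section SpectralBound.
Variable R : realType.

Definition extremal_radius (n : nat) : R :=
  (Num.sqrt (n%:R ^+ 2 - 8) + n%:R - 4) / 2.

Lemma extremal_radius_gt0 n : (3 < n)%N -> 0 < extremal_radius n.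
Proof.
rewrite -(ler_nat R) => n4; rewrite /extremal_radius divr_gt0 //.
have : 0 < Num.sqrt (n%:R ^+ 2 - 8) :> R by rewrite sqrtr_gt0; nra.
lra.
Qed.

Lemma extremal_radius_root n : (3 < n)%N ->
  extremal_radius n ^+ 2 =
  (n%:R - 3 - 1) * extremal_radius n + 2 * (n%:R - 3).
Proof.
rewrite -(ler_nat R) => n4; rewrite /extremal_radius.
have /sqr_sqrtr : 0 <= n%:R ^+ 2 - 8 :> R by nra.
by move: (Num.sqrt _) => s; lra.
Qed.

(** The claim amounts to [n ^ 2 - 8 > 16], which fails at [n = 4]; this is why order 4 is treated
    apart. *)
Lemma half_lt_extremal_radius n : (4 < n)%N -> n%:R / 2 < extremal_radius n.
Proof.
rewrite -(ler_nat R) => n5; rewrite /extremal_radius.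
rewrite ltr_pM2r ?invr_gt0 //.
have : 4 < Num.sqrt (n%:R ^+ 2 - 8) :> R; last by lra.
rewrite -[X in X < _]ger0_norm // -sqrtr_sqr ltr_sqrt; nra.
Qed.

Variable n : nat.
Implicit Types (G : signed_graph 'I_n) (lam : R).

Lemma adjmxE G i j : adjmx R G i j = (edge_val G i j)%:~R.
Proof. by rewrite mxE /edge_val; case: ifP. Qed.

(** Switching at the vertices where an eigenvector is negative replaces its entries by their
    absolute values and keeps the eigenvalue. *)
Lemma eigenvalue_switched G lam : eigenvalue (adjmx R G) lam ->
  exists (U : {set 'I_n}) (x : 'I_n -> R),
    [/\ forall i, 0 <= x i, exists i, x i != 0 &
        forall i, \sum_j (edge_val (switch G U) i j)%:~R * x j = lam * x i].
Proof.
move=> /eigenvalueP[y yA y0].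
pose U := [set i | y 0 i < 0].
have yU i : `|y 0 i| = (switch_factor U i)%:~R * y 0 i.
  rewrite /switch_factor inE; case: ltP => yi.
    by rewrite ltr0_norm // mulrN1z mulN1r.
  by rewrite ger0_norm // mul1r.
exists U, (fun i => `|y 0 i|); split=> // [|i].
  apply/existsP; apply: contraNT y0 => /existsPn H.
  apply/eqP/rowP => i; rewrite mxE; apply/eqP.
  by have := H i; rewrite negbK normr_eq0.
have /rowP/(_ i) := yA; rewrite !mxE => yAi.
rewrite yU mulrCA -yAi mulr_sumr; apply: eq_bigr => j _.
rewrite yU adjmxE edge_val_switch (edge_val_sym G j) !rmorphM /=.
have : (switch_factor U j)%:~R * (switch_factor U j)%:~R = 1 :> R.
  by rewrite -rmorphM switch_factor_sqr.
move: (switch_factor U j)%:~R (switch_factor U i)%:~R => ej ei E.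
by rewrite -[RHS]mul1r -E; ring.
Qed.

Lemma edge_valR_cases G i j :
  [\/ (edge_val G i j)%:~R = 0 :> R, (edge_val G i j)%:~R = 1 :> R
    | (edge_val G i j)%:~R = -1 :> R].
Proof.
by case: (edge_val_cases G i j) => ->;
  [constructor 1|constructor 2|constructor 3]; rewrite ?mulrN1z.
Qed.

Lemma edge_valR_triangle G i j k : C3neg_free G ->
  (edge_val G i j)%:~R * (edge_val G j k)%:~R * (edge_val G k i)%:~R != -1 :> R.
Proof.
move=> free; rewrite -!rmorphM /= -[X in _ != X]mulrN1z eqr_int.
exact: edge_val_triangle.
Qed.

Lemma eigenvalue_le G lam : unbalanced G -> C3neg_free G ->
  eigenvalue (adjmx R G) lam ->
  lam < extremal_radius n \/
  lam = extremal_radius n /\ switching_equiv G (Gst 1 (n - 3)).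
Proof.
move=> unb free /eigenvalue_switched[U [x [x_ge0 x_neq0 x_eigen]]].
have n4 := card_gt3 unb free; rewrite card_ord in n4.
have := @eigen_le_extremal R 'I_n
  (fun i j => (edge_val (switch G U) i j)%:~R) x lam _ _ _ x_ge0 x_neq0 x_eigen
  _ (extremal_radius n) (n%:R - 3).
case.
- by move=> i j; rewrite edge_val_sym.
- by move=> i; rewrite edge_val_diag.
- by move=> i j; exact: edge_valR_cases.
- by move=> i j k; apply: edge_valR_triangle; apply: C3neg_free_switch.
- by rewrite card_ord.
- by rewrite card_ord subrK.
- exact: extremal_radius_gt0.
- exact: extremal_radius_root.
- have [u [v uv]] := unbalanced_neg_edge (unbalanced_switch U unb).
  by exists u, v; rewrite uv mulrN1z.
- by left.
move=> [-> [u [v [w ext]]]]; right; split=> //; exists U.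
move: n4 => {unb free x x_ge0 x_neq0 x_eigen}.
(* Writing the order as [m.+4] lets [n - 3] reduce to the [m.+1] of [extremal_sg_iso]. *)
case: n G U u v w ext => [|[|[|[|m]]]] // G U u v w ext _.
by rewrite subSS !subSS subn0; apply: extremal_sg_iso ext.
Qed.

Lemma adjmx_opp G : adjmx R (opp_graph G) = - adjmx R G.
Proof.
by apply/matrixP => i j; rewrite adjmxE mxE adjmxE edge_val_opp rmorphN.
Qed.

Lemma eigenvalue_opp G lam :
  eigenvalue (adjmx R G) lam -> eigenvalue (adjmx R (opp_graph G)) (- lam).
Proof.
move=> /eigenvalueP[y yA y0]; apply/eigenvalueP; exists y => //.
by rewrite adjmx_opp mulmxN yA scaleNr.
Qed.

Lemma eigenvalue_ge G lam : unbalanced G -> C3neg_free G ->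
  eigenvalue (adjmx R G) lam ->
  - lam < extremal_radius n \/
  - lam = extremal_radius n /\ switching_equiv G (Gst 1 (n - 3)).
Proof.
move=> unb free /eigenvalue_opp eig.
have n4 := card_gt3 unb free; rewrite card_ord in n4.
move: n4; rewrite leq_eqVlt => /orP[/eqP n4|n5].
  have := card4_opp (_ : #|'I_n| = 4) unb free; rewrite card_ord => /(_ (esym n4)).
  move=> [unb' free'].
  have [|[E eqv]] := eigenvalue_le unb' free' eig; [by left|right; split=> //].
  move: eqv; have -> : (n - 3)%N = 1%N by rewrite -n4.
  exact: switching_equiv_opp.
left; apply: le_lt_trans (half_lt_extremal_radius n5).
move: eig => /eigenvalue_switched[U [x [x_ge0 x_neq0 x_eigen]]].
rewrite -[X in X%:R]card_ord.
apply: (@eigen_le_half_card R 'I_n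
  (fun i j => (edge_val (switch (opp_graph G) U) i j)%:~R) x) => //.
- by move=> i j; rewrite edge_val_sym.
- by move=> i j; exact: edge_valR_cases.
(* Negating three entries negates their product, so a product different from -1 in [G] becomes one
   different from 1. *)
move=> i j k; have := edge_valR_triangle i j k (C3neg_free_switch (U := U) free).
rewrite !edge_val_switch !edge_val_opp !mulrN !rmorphN /= mulrNN mulrN.
by rewrite eqr_oppLR.
Qed.

(** The explicit eigenvector of the extremal graph is pulled back along the isomorphism and
    multiplied by the switching factors. *)
Lemma extremal_radius_eigenvalue G : (3 < n)%N ->
  switching_equiv G (Gst 1 (n - 3)) -> eigenvalue (adjmx R G) (extremal_radius n).
Proof.
move=> n4 [U /edge_val_sg_iso].
have := extremal_radius_root n4; have := extremal_radius_gt0 n4.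
move: (extremal_radius n) => r r0 r_root.
have [m nm] : exists m, n = m.+4 by exists (n - 4)%N; lia.
have -> : (n - 3)%N = m.+1 by lia.
have {}r_root : r ^+ 2 = m%:R * r + 2 * m.+1%:R.
  by rewrite r_root nm -(addn3 m.+1) -(addn1 m) !natrD; ring.
move=> [f f_bij Hf].
pose y : Gst_vertex 1 m.+1 -> R := Gst_eigenvector r.
apply/eigenvalueP; exists (\row_i ((switch_factor U i)%:~R * y (f i))).
  apply/rowP => i; rewrite !mxE.
  rewrite mulrCA -(Gst_eigen _ r_root) (reindex f) /=; last exact: onW_bij.
  rewrite mulr_sumr; apply: eq_bigr => j _.
  rewrite mxE adjmxE (edge_val_unswitch G U) (edge_val_sym _ j) Hf !rmorphM /=.
  have : (switch_factor U j)%:~R * (switch_factor U j)%:~R = 1 :> R.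
    by rewrite -rmorphM switch_factor_sqr.
  move: (switch_factor U j)%:~R (switch_factor U i)%:~R => ej ei E.
  by rewrite -[RHS]mul1r -E; rewrite /y; ring.
(* The vector is nonzero at the preimage of [v], where its absolute value is [m.+1]. *)
have [g _ gK] := f_bij.
apply/negP => /eqP/rowP/(_ (g (inr false))); rewrite !mxE gK /=.
move/eqP; rewrite mulf_eq0 pnatr_eq0 orbF intr_eq0 /switch_factor.
by case: ifP.
Qed.

End SpectralBound.

Theorem theorem1p3 (R : realType) (n : nat) (G : signed_graph 'I_n)
    (hconn : connected G) (hunb : unbalanced G) (hfree : C3neg_free G) :
  spectral_radius R G <= (Num.sqrt (n%:R ^+ 2 - 8) + n%:R - 4) / 2 /\
  (spectral_radius R G = (Num.sqrt (n%:R ^+ 2 - 8) + n%:R - 4) / 2 <->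
   switching_equiv G (Gst 1 (n - 3))).
Proof.
have n4 := card_gt3 hunb hfree; rewrite card_ord in n4.
rewrite -/(extremal_radius R n).
have r0 := extremal_radius_gt0 R n4.
pose ev := eigenvalues (adjmx R G).
have evP a : a \in ev -> eigenvalue (adjmx R G) a by rewrite mem_eigenvalues.
(* The default 0 of [head] and [last] is harmless, since it lies strictly below the positive
   bound. *)
have headP : lambda_max (adjmx R G) = 0 \/ lambda_max (adjmx R G) \in ev.
  rewrite /lambda_max -/ev; case: (ev) => [|a s]; first by left.
  by right; rewrite mem_head.
have lastP : lambda_min (adjmx R G) = 0 \/ lambda_min (adjmx R G) \in ev.
  rewrite /lambda_min -/ev; case: (ev) => [|a s]; first by left.
  by right; rewrite /= mem_last.
have Hmax : lambda_max (adjmx R G) < extremal_radius R n \/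
    lambda_max (adjmx R G) = extremal_radius R n /\
    switching_equiv G (Gst 1 (n - 3)).
  by case: headP => [->|/evP/eigenvalue_le]; [left|apply].
have Hmin : - lambda_min (adjmx R G) < extremal_radius R n \/
    - lambda_min (adjmx R G) = extremal_radius R n /\
    switching_equiv G (Gst 1 (n - 3)).
  by case: lastP => [->|/evP/eigenvalue_ge]; [left; rewrite oppr0|apply].
have rad_le : spectral_radius R G <= extremal_radius R n.
  rewrite /spectral_radius ge_max.
  by case: Hmax => [/ltW ->|[-> _]]; rewrite ?lexx;
     case: Hmin => [/ltW ->|[-> _]]; rewrite ?lexx.
split=> //; split=> [E|eqv].
  case: Hmax => [Lmax|[_ //]]; case: Hmin => [Lmin|[_ //]].
  by move: E => /eqP; rewrite lt_eqF // /spectral_radius gt_max Lmax.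
apply: le_anti; rewrite rad_le /= /spectral_radius le_max.
(* In the extremal case the bound is itself an eigenvalue, hence at most the head of the
   nonincreasing list. *)
apply/orP; left.
have := extremal_radius_eigenvalue R n4 eqv; rewrite -mem_eigenvalues -/ev.
have := eigenvalues_sorted (adjmx R G); rewrite /lambda_max -/ev.
case: (ev) => [//|a s] /= srt; rewrite inE => /orP[/eqP -> //|].
have tr : transitive (>=%R : rel R) by move=> ? ? ? h1 h2; exact: le_trans h2 h1.
by move: srt; rewrite path_sortedE // => /andP[/allP h _] /h.
Qed.
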